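(* Let $n \geq 4$ and for $1\le i\le n-1$ let $s_i=(i,i+1)\in S_n$. \begin{enumerate} \item A real representation $\pi$ of $S_n$ is spinorial if and only if $\chi_\pi(1) \equiv \chi_\pi(s_1s_3) \pmod 8$ and $\chi_\pi(1)-\chi_\pi(s_1)$ is congruent to $0$ or $6 \pmod 8$. \item A real representation $\pi$ of the alternating group $A_n$ is spinorial if and only if $\chi_\pi(1) \equiv \chi_\pi(s_1s_3) \pmod 8$. \end{enumerate}
   Context: All representations are finite-dimensional real representations, and $\chi_\pi$ denotes the character of $\pi$. A real representation of a finite group $G$ on a Euclidean space $V$ is regarded (after conjugation) as a homomorphism $\pi: G\to \mathrm{O}(V)$. Let $C(V)$ be the Clifford algebra of $V$ (quotient of the tensor algebra by the ideal generated by $v\otimes v+|v|^2$), $\mathrm{Pin}(V)\subset C(V)^\times$ the Pin group, and $\rho:\mathrm{Pin}(V)\to \mathrm{O}(V)$ the standard double cover with kernel $\{\pm1\}$ (for a unit vector $v$, $\rho(v)$ is the reflection in $v^\perp$). The representation $\pi$ is called spinorial if there is a homomorphism $\hat\pi: G\to\mathrm{Pin}(V)$ with $\rho\circ\hat\pi=\pi$. *)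

(* Defs.v *)
From HB Require Import structures.
From mathcomp Require Import all_boot all_order all_algebra all_fingroup all_solvable.
From mathcomp Require Import mxrepresentation.
From mathcomp Require Import reals.
Set Implicit Arguments. Unset Strict Implicit. Unset Printing Implicit Defensive.
Import Order.TTheory GRing.Theory Num.Theory.
Local Open Scope ring_scope.

(* The Clifford algebra C(V) of V = R^N (column vectors 'cV[R]_N) with the *)
(* standard Euclidean inner product, relation v*v = -|v|^2.                *)
(* Concrete model: C(V) has basis e_S, S a subset of {0..N-1}, where        *)
(* e_S = e_{i1} ... e_{ik} (i1 < ... < ik).  An element is the function    *)
(* S |-> coefficient of e_S.  The product is                               *)
(*   e_S e_T = (-1)^(#{(i,j) | i in S, j in T, j < i} + #|S :&: T|) e_{S Δ T} *)
(* which is the multiplication table of the quotient of the tensor algebra *)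
(* by the ideal generated by v (x) v + |v|^2 (e_i e_j = - e_j e_i, i<>j,   *)
(* e_i^2 = -1).                                                            *)

Definition clif (R : pzRingType) (N : nat) := {ffun {set 'I_N} -> R}.

Definition symdiff (N : nat) (S T : {set 'I_N}) : {set 'I_N} :=
  (S :\: T) :|: (T :\: S).

Definition clsign (R : pzRingType) (N : nat) (S T : {set 'I_N}) : R :=
  (-1) ^+ (#|[set p : 'I_N * 'I_N | (p.1 \in S) && (p.2 \in T) && (p.2 < p.1)%N]|
           + #|S :&: T|)%N.

Definition clmul (R : pzRingType) (N : nat) (x y : clif R N) : clif R N :=
  [ffun U => \sum_(S : {set 'I_N}) \sum_(T : {set 'I_N} | symdiff S T == U)
                clsign R S T * x S * y T].

Definition clone (R : pzRingType) (N : nat) : clif R N :=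
  [ffun U : {set 'I_N} => (U == set0)%:R].

Definition clvec (R : pzRingType) (N : nat) (w : 'cV[R]_N) : clif R N :=
  [ffun U => \sum_(i < N | U == [set i]) w i 0].

Definition clalpha (R : pzRingType) (N : nat) (x : clif R N) : clif R N :=
  [ffun U : {set 'I_N} => (-1) ^+ #|U| * x U].

Definition unitvec (R : pzRingType) (N : nat) (w : 'cV[R]_N) : bool :=
  (w^T *m w) 0 0 == 1.

(* Pin(V): the subgroup of C(V)^x generated by the unit vectors.  Since    *)
(* the inverse of a unit vector v is -v, again a unit vector, this is the  *)
(* set of all finite products of unit vectors.                             *)
Definition Pin (R : pzRingType) (N : nat) (x : clif R N) : Prop :=
  exists vs : seq 'cV[R]_N,
    (forall v, v \in vs -> unitvec v) /\
    x = foldr (fun v acc => clmul (clvec v) acc) (clone R N) vs.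

(* rho : Pin(V) -> O(V) is the twisted adjoint action                       *)
(*   rho(x)(w) = alpha(x) w x^{-1};                                          *)
(* for a unit vector v, rho(v) is the reflection in v^perp.  Since x is     *)
(* invertible, "rho(x) = M" (M a matrix acting on column vectors) is        *)
(* equivalent to: alpha(x) w = (M w) x for all w in V.                      *)
Definition rho_is (R : pzRingType) (N : nat) (x : clif R N) (M : 'M[R]_N) : Prop :=
  forall w : 'cV[R]_N, clmul (clalpha x) (clvec w) = clmul (clvec (M *m w)) x.

Definition orthogonal_mx (R : pzRingType) (N : nat) (M : 'M[R]_N) : Prop :=
  M *m M^T = 1%:M.

Definition spinorial (R : pzRingType) (gT : finGroupType) (G : {group gT})
    (N : nat) (pi : gT -> 'M[R]_N) : Prop :=
  exists pihat : gT -> clif R N,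
    [/\ {in G, forall g, Pin (pihat g)},
        {in G &, forall g h, pihat (g * h)%g = clmul (pihat g) (pihat h)} &
        {in G, forall g, rho_is (pihat g) (pi g)}].

(* s_i = (i, i+1) in S_n, with the paper's 1-based labels {1..n}:           *)
(* in 'I_n (= {0..n-1}) this is the transposition of i-1 and i.             *)
(* (Defaults to the identity if i = 0 or i >= n, never used here.)          *)
Definition sadj (n i : nat) : 'S_n :=
  match @insub _ (fun k => (k < n)%N) 'I_n i.-1, @insub _ (fun k => (k < n)%N) 'I_n i with
  | Some a, Some b => if (0 < i)%N then tperm a b else 1%g
  | _, _ => 1%g
  end.

Definition chi (R : pzRingType) (gT : finGroupType) (N : nat) (pi : gT -> 'M[R]_N)
  (g : gT) : R := \tr (pi g).

Definition congr_mod (R : pzRingType) (a b : R) (m : int) : Prop :=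
  exists k : int, a - b = (m * k)%:~R.

(* Main.v *)
Require Import Defs.
From HB Require Import structures.
From mathcomp Require Import all_boot all_order all_algebra all_fingroup all_solvable.
From mathcomp Require Import mxrepresentation alt.
From mathcomp Require Import reals.
From mathcomp Require Import zify ring lra.
Set Implicit Arguments. Unset Strict Implicit. Unset Printing Implicit Defensive.
Import Order.TTheory GRing.Theory Num.Theory.

(* Let x be a lift to Pin(V) of an orthogonal involution M whose (-1)-eigenspace *)
(* has dimension m. Up to sign x is the product of an orthonormal basis of that  *)
(* eigenspace, so x^2 = (-1)^(m(m+1)/2), while 2m = tr 1 - tr M. Hence lifts of  *)
(* pi(s_1) and of pi(s_1 s_3) square to 1 exactly under the stated congruences;  *)
(* for s_1 s_3 the number m is even, because s_1 s_3 = (s_1 s_2)(s_2 s_3) is a   *)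
(* product of 3-cycles, so that pi(s_1 s_3) has determinant 1.                   *)
(*   Conversely, lifts can be chosen so that the Coxeter relations hold: the     *)
(* braid relations by successive changes of sign, the others by the congruences. *)
(* For A_n one lifts the even elements s_i s_1 to y_i and lets s_i act on        *)
(* C(V) x {0,1} by (x,0) |-> (x y_i,1) and (x,1) |-> (x y_i^-1,0), which gives   *)
(* an action of S_n; the orbit of (1,0) yields the lift of A_n.                  *)

(** * The Coxeter presentation of the symmetric group *)

(** Lifting is a question of signs. A lift of an orthogonal matrix to Pin(V) exists because
    reflections generate O(V) ([orth_lift]), and it is unique up to sign ([lift_unique]). So [pi] is
    spinorial exactly when lifts of generators can be chosen to satisfy the defining relations. For
    a relation g^2 = 1 the sign of the lift is irrelevant, and [lift_involution] reads the square of
    the lift off the trace. This yields the necessary congruences ([spinorial_involution],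
    [spinorial_s1s3]) and, in the other direction, the relations on squares
    ([double_transposition_sqr]). A cubic relation changes sign with the lift, so it can always be
    arranged ([lift_system]). That no further relation has to be checked is the Coxeter
    presentation, in the form [coxeter_action_perm]: maps satisfying the Coxeter relations extend to
    an action of S_n. It is applied to maps on C(V) with a parity flag ([twist_coxeter],
    [twisted_product]), which serves S_n and A_n at once through [twisted_lift]. *)

Record coxeter_action (k : nat) (X : Type) (f : nat -> X -> X) : Prop := {
  cox_invol : forall i x, i < k -> f i (f i x) = x;
  cox_comm : forall i j x, i.+1 < j -> j < k -> f i (f j x) = f j (f i x);
  cox_braid : forall i x, i.+1 < k -> f i (f i.+1 (f i x)) = f i.+1 (f i (f i.+1 x)) }.

Definition wact (X : Type) (f : nat -> X -> X) (w : seq nat) (x : X) : X :=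
  foldl (fun x i => f i x) x w.

(** Equality in the abstract Coxeter group, expressed as agreement in every Coxeter action, without
    constructing the group from its presentation. *)
Definition weq (k : nat) (w1 w2 : seq nat) : Prop :=
  forall X (f : nat -> X -> X), coxeter_action k f ->
  forall x, wact f w1 x = wact f w2 x.

Definition below (k : nat) : pred (seq nat) := all (fun i => i < k).

Lemma below_rcons k w i : below k (rcons w i) = (i < k) && below k w.
Proof. exact: all_rcons. Qed.

Lemma below_cat k w1 w2 : below k (w1 ++ w2) = below k w1 && below k w2.
Proof. exact: all_cat. Qed.

(** The word k-1, k-2, ..., k-l. For l from 0 to k these represent the cosets of the subgroup
    generated by the letters below k-1. *)
Fixpoint descent (k l : nat) : seq nat :=
  if l is l'.+1 then rcons (descent k l') (k - l'.+1) else [::].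

Lemma wact_cat X (f : nat -> X -> X) w1 w2 x :
  wact f (w1 ++ w2) x = wact f w2 (wact f w1 x).
Proof. by rewrite /wact foldl_cat. Qed.

Lemma wact_rcons X (f : nat -> X -> X) w i x :
  wact f (rcons w i) x = f i (wact f w x).
Proof. by rewrite -cats1 wact_cat. Qed.

Lemma descent_comm k l i X (f : nat -> X -> X) x : coxeter_action k f ->
  i.+1 < k - l -> wact f (descent k l) (f i x) = f i (wact f (descent k l) x).
Proof.
move=> cf; elim: l x => [//|l IH] x il /=.
rewrite !wact_rcons IH; last by lia.
by rewrite -(cox_comm cf) //; lia.
Qed.

(** The letter i commutes back to the pair i, i-1 of the descent; the braid relation turns it into
    i-1, which commutes with all earlier letters. *)
Lemma descent_shift k l i X (f : nat -> X -> X) x : coxeter_action k f ->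
  l <= k -> k - l < i -> i < k ->
  f i (wact f (descent k l) x) = wact f (descent k l) (f i.-1 x).
Proof.
move=> cf; elim: l x => [|l IH] x lk li ik; first by lia.
rewrite /= !wact_rcons.
have [eqi|nei] := eqVneq i (k - l).
  case: l IH lk li eqi => [|l] IH lk li eqi; first by lia.
  rewrite /= !wact_rcons -eqi descent_comm //; last by lia.
  have -> : k - l.+2 = i.-1 by lia.
  case: i {IH} eqi li ik => [|i] eqi li ik; first by lia.
  by rewrite /= (cox_braid cf).
rewrite -IH //; try lia.
by rewrite -(cox_comm cf) //; lia.
Qed.

(** A letter appended to a normal form lengthens the descent, cancels its last letter, or passes
    through it, unchanged or lowered by 1, and joins [w']. *)
Lemma weq_normal_form k w : below k.+1 w ->
  exists w' l, [/\ below k w', l <= k.+1 & weq k.+1 w (w' ++ descent k.+1 l)].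
Proof.
elim/last_ind: w => [|w i IH]; first by exists [::], 0.
rewrite below_rcons => /andP[ik /IH [w' [l [bw' lk E]]]].
have H X (f : nat -> X -> X) x : coxeter_action k.+1 f ->
    wact f (rcons w i) x = f i (wact f (descent k.+1 l) (wact f w' x)).
  by move=> cf; rewrite wact_rcons E // wact_cat.
case: (ltngtP i (k.+1 - l)) => [lti|gti|eqi].
- have [eqi|nei] := eqVneq i.+1 (k.+1 - l).
    exists w', l.+1; split=> //; first by lia.
    move=> X f cf x; rewrite H // wact_cat /= wact_rcons; congr (f _ _); lia.
  exists (rcons w' i), l; split=> //.
    by rewrite below_rcons bw' andbT; lia.
  by move=> X f cf x; rewrite H // wact_cat wact_rcons descent_comm //; lia.
- exists (rcons w' i.-1), l; split=> //.
    by rewrite below_rcons bw' andbT; lia.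
  by move=> X f cf x; rewrite H // wact_cat wact_rcons descent_shift.
- case: l lk eqi E H => [|l] lk eqi E H; first by lia.
  exists w', l; split=> //; first by lia.
  move=> X f cf x; rewrite H // wact_cat /= wact_rcons -eqi (cox_invol cf) //.
Qed.

(** The adjacent transpositions act on all of [nat], so that an induction on the number of
    generators does not change the type acted on. *)
Definition swap (i x : nat) : nat :=
  if x == i then i.+1 else if x == i.+1 then i else x.

Lemma swap_coxeter k : coxeter_action k swap.
Proof.
by split=> [i x _|i j x ij _|i x _]; rewrite /swap;
   do ![case: eqP => //=]; lia.
Qed.

Lemma wact_swap_below k w x : below k w -> k < x -> wact swap w x = x.
Proof.
elim/last_ind: w => [//|w i IH]; rewrite below_rcons => /andP[ik bw] kx.
by rewrite wact_rcons IH // /swap; do ![case: eqP => //=]; lia.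
Qed.

Lemma wact_swap_descent k l : l <= k -> wact swap (descent k l) k = k - l.
Proof.
elim: l => [|l IH] lk; first by rewrite subn0.
by rewrite /= wact_rcons IH ?(ltnW lk) // /swap; do ![case: eqP => //=]; lia.
Qed.

(* The faithfulness half of the presentation: the Coxeter relations already *)
(* imply every relation that holds between the adjacent transpositions.     *)
Lemma weq_nil k w : below k w -> (forall x, wact swap w x = x) -> weq k w [::].
Proof.
elim: k w => [|k IH] w; first by case: w.
move=> /weq_normal_form [w' [l [bw' lk E]]] w1.
have sw x : wact swap w x = wact swap (descent k.+1 l) (wact swap w' x).
  by rewrite E ?wact_cat //; apply: swap_coxeter.
(* The letters of [w'] fix the top point k+1, and the descent sends it to k+1-l. *)
have l0 : l = 0.
  have := w1 k.+1; rewrite sw (wact_swap_below bw') // wact_swap_descent //; lia.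
move: sw E; rewrite l0 /= cats0 => sw E X f cf x; rewrite E //.
apply: (IH w' bw' _ X f) => [y|]; first by rewrite -[in RHS](w1 y) sw.
by case: cf => c1 c2 c3; split=> *; [apply: c1|apply: c2|apply: c3]; lia.
Qed.

Section SymmetricGroup.
Variable n : nat.

(* The indices are 0-based: [adj i] is the paper's s_(i+1). *)
Definition adj (i : nat) : 'S_n := sadj n i.+1.

Lemma adjE i (h0 : i < n) (h1 : i.+1 < n) : adj i = tperm (Ordinal h0) (Ordinal h1).
Proof.
rewrite /adj /sadj /=; case: insubP => [a _ va|]; last by rewrite h0.
case: insubP => [b _ vb|]; last by rewrite h1.
by congr tperm; apply: val_inj.
Qed.

Lemma val_adj i (x : 'I_n) : i.+1 < n -> val (adj i x) = swap i x.
Proof.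
move=> h1; rewrite (adjE (ltnW h1)) permE /= /swap -!val_eqE /=.
by case: eqP => //= _; case: eqP.
Qed.

Definition wperm (w : seq nat) : 'S_n := (\prod_(i <- w) adj i)%g.

Lemma val_wperm w (x : 'I_n) : below n.-1 w -> val (wperm w x) = wact swap w x.
Proof.
elim/last_ind: w => [|w i IH]; first by rewrite /wperm big_nil perm1.
rewrite below_rcons => /andP[ik bw].
by rewrite wact_rcons -IH // /wperm big_rcons permM val_adj //; lia.
Qed.

Lemma wperm_cat w1 w2 : wperm (w1 ++ w2) = (wperm w1 * wperm w2)%g.
Proof. exact: big_cat. Qed.

Lemma adjK i : i.+1 < n -> (adj i * adj i = 1)%g.
Proof. by move=> h; rewrite (adjE (ltnW h)); exact: tperm2. Qed.

Lemma tperm_word (x y : 'I_n) : exists2 w, below n.-1 w & wperm w = tperm x y.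
Proof.
wlog xy : x y / x <= y.
  move=> W; case: (leqP x y) => [/W //|/ltnW /W [w]].
  by rewrite tpermC; exists w.
have [d Ed] : exists d, y = x + d :> nat by exists (y - x); lia.
elim: d y xy Ed => [|d IH] y xy Ed.
  exists [::] => //; rewrite /wperm big_nil.
  have -> : y = x by apply: val_inj => /=; lia.
  by rewrite tperm1.
have lt1 : x + d < n by have := ltn_ord y; lia.
have lt2 : (x + d).+1 < n by have := ltn_ord y; lia.
have ey : y = Ordinal lt2 by apply: val_inj => /=; lia.
case: d IH Ed lt1 lt2 ey => [|d] IH Ed lt1 lt2 ey.
  exists [:: x : nat] => /=; first by rewrite /= andbT; have := ltn_ord y; lia.
  have lt3 : x.+1 < n by rewrite -[x : nat]addn0.
  rewrite /wperm big_seq1 (adjE (ltn_ord x) lt3); congr tperm; apply: val_inj => //=; lia.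
have [|//|w bw Ew] := IH (Ordinal lt1); first by rewrite /= leq_addr.
(* Conjugating the transposition of x and y-1 by that of y-1 and y gives the one of x and y. *)
exists ((x + d.+1) :: rcons w (x + d.+1)).
  by rewrite /= below_rcons bw; have := ltn_ord y; lia.
rewrite -cat1s -cats1 catA !wperm_cat Ew /wperm !big_seq1.
rewrite (adjE lt1 lt2) -ey -[X in (X * _ * _)%g]tpermV -mulgA -conjgE tpermJ tpermL.
by rewrite tpermD //; apply/eqP => /(congr1 val) /=; lia.
Qed.

Lemma perm_word (g : 'S_n) : exists w, below n.-1 w && (wperm w == g).
Proof.
have [ts -> _] := prod_tpermP g.
elim: ts => [|t ts [w /andP[bw /eqP Ew]]].
  by exists [::]; rewrite big_nil /wperm big_nil /=.
have [w' bw' Ew'] := tperm_word t.1 t.2.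
by exists (w' ++ w); rewrite below_cat bw bw' wperm_cat Ew Ew' big_cons /=.
Qed.

Lemma adj_ind (P : 'S_n -> Prop) : P 1%g ->
  (forall g i, i.+1 < n -> P g -> P (g * adj i)%g) -> forall g, P g.
Proof.
move=> P1 Pm g; have [w /andP[+ /eqP <-]] := perm_word g.
elim/last_ind: w => [|w i IH]; first by rewrite /wperm big_nil.
rewrite below_rcons => /andP[ik bw]; rewrite /wperm big_rcons.
by apply: Pm; [lia | apply: IH].
Qed.

Lemma wact_rev X (f : nat -> X -> X) w x : coxeter_action n.-1 f -> below n.-1 w ->
  wact f (rev w) (wact f w x) = x.
Proof.
move=> cf; elim: w x => [//|i w IH] x /= /andP[ik bw].
by rewrite rev_cons wact_rcons IH // (cox_invol cf).
Qed.

Lemma weq_wperm w1 w2 : 0 < n -> below n.-1 w1 -> below n.-1 w2 ->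
  wperm w1 = wperm w2 -> weq n.-1 w1 w2.
Proof.
move=> n_gt0 b1 b2 e X f cf x.
have b2r : below n.-1 (rev w2) by rewrite /below all_rev.
have : weq n.-1 (w1 ++ rev w2) [::].
  apply: weq_nil => [|y]; first by rewrite below_cat b1 b2r.
  have cs := swap_coxeter n.-1.
  case: (ltnP y n) => yn.
    rewrite wact_cat -(val_wperm (Ordinal yn) b1) e val_wperm //=.
    exact: wact_rev.
  have n1 : n.-1 < y by lia.
  by rewrite wact_cat !(wact_swap_below _ n1).
move=> /(_ X f cf x); rewrite wact_cat /= => e1.
by rewrite -[wact f w1 x](wact_rev _ cf b2r) e1 revK.
Qed.

(** Each permutation acts through a chosen word; by [weq_wperm] the result does not depend on the
    choice. *)
Lemma coxeter_action_perm X (f : nat -> X -> X) : 0 < n -> coxeter_action n.-1 f ->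
  exists act : 'S_n -> X -> X,
    [/\ forall x, act 1%g x = x,
        forall g h x, act (g * h)%g x = act h (act g x) &
        forall i x, i.+1 < n -> act (adj i) x = f i x].
Proof.
move=> n_gt0 cf; pose wd g := xchoose (perm_word g).
have wdP g : below n.-1 (wd g) /\ wperm (wd g) = g.
  by have /andP[? /eqP ?] := xchooseP (perm_word g).
exists (fun g => wact f (wd g)); split=> [x|g h x|i x ik].
- have [b1 e1] := wdP 1%g.
  by rewrite (weq_wperm (w2 := [::]) n_gt0 b1 _ _ cf) // e1 /wperm big_nil.
- have [[[b1 e1] [b2 e2]] [b3 e3]] := (wdP g, wdP h, wdP (g * h)%g).
  rewrite -wact_cat; apply: (weq_wperm n_gt0 b3 _ _ cf).
    by rewrite below_cat b1 b2.
  by rewrite wperm_cat e1 e2 e3.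
- have [b1 e1] := wdP (adj i).
  rewrite (weq_wperm (w2 := [:: i]) n_gt0 b1 _ _ cf) // ?e1 /wperm ?big_seq1 //=.
  by rewrite andbT; lia.
Qed.

End SymmetricGroup.

Section AdjacentTranspositions.
Variable n : nat.
Implicit Types i j : nat.
Local Notation s := (adj n).

Lemma adjC i j : (i.+1 < j -> j.+1 < n -> s i * s j = s j * s i)%g.
Proof.
move=> ij jn; apply/permP => x; apply: val_inj; rewrite !permM !val_adj //; try lia.
by rewrite -(cox_comm (swap_coxeter n.-1)) //; lia.
Qed.

Lemma adj2_sqr i j : i.+1 < j -> j.+1 < n -> (s i * s j * (s i * s j) = 1)%g.
Proof.
move=> ij jn; rewrite {2}adjC // mulgA -(mulgA (s i)) adjK // mulg1 adjK //; lia.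
Qed.

Lemma adj_braid i : i.+2 < n -> (s i * s i.+1 * s i = s i.+1 * s i * s i.+1)%g.
Proof.
move=> ij; apply/permP => x; apply: val_inj; rewrite !permM !val_adj //; try lia.
by rewrite (cox_braid (swap_coxeter n.-1)) //; lia.
Qed.

Lemma odd_adj i : i.+1 < n -> odd_perm (s i).
Proof. by move=> h; rewrite (adjE (ltnW h)) odd_tperm -val_eqE /= neq_ltn ltnSn. Qed.

Lemma adj2_Alt i j : i.+1 < n -> j.+1 < n -> (s i * s j)%g \in Alt 'I_n.
Proof. by move=> hi hj; rewrite Alt_even odd_permM !odd_adj. Qed.

Lemma adj2_cube i : i.+2 < n -> (s i * s i.+1 * (s i * s i.+1 * (s i * s i.+1)) = 1)%g.
Proof.
move=> h; have s2 := adjK (ltnW h); have s2' := adjK h.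
transitivity ((s i * s i.+1 * s i) * (s i.+1 * s i * s i.+1))%g.
  by rewrite !mulgA.
by rewrite -adj_braid // -!mulgA (mulgA (s i) (s i)) s2 mul1g (mulgA (s i.+1)) s2' mul1g s2.
Qed.

Lemma adj_conj i : i.+2 < n -> s i.+1 = (s i ^ (s i.+1 * s i))%g.
Proof.
move=> h; have s2 := adjK (ltnW h).
have sV : ((s i)^-1 = s i)%g by apply/eqP; rewrite eq_invg_mul s2.
have sV' : ((s i.+1)^-1 = s i.+1)%g by apply/eqP; rewrite eq_invg_mul (adjK h).
rewrite conjgE invMg sV sV'.
transitivity (s i * (s i.+1 * s i * s i.+1) * s i)%g; last by rewrite !mulgA.
by rewrite -adj_braid // !mulgA s2 mul1g -mulgA s2 mulg1.
Qed.

Lemma adj2_conj_right i j : i.+1 < j -> j.+2 < n ->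
  ((s i * s j) ^ (s j.+1 * s j) = s i * s j.+1)%g.
Proof.
move=> ij jn; have fixi l : i.+1 < l -> l.+1 < n -> (s i ^ s l = s i)%g.
  by move=> il ln; apply/conjg_fixP/commgP/adjC.
by rewrite conjMg -adj_conj // conjgM !fixi //; lia.
Qed.

Lemma adj2_conj_left i j : i.+2 < j -> j.+1 < n ->
  ((s i * s j) ^ (s i.+1 * s i) = s i.+1 * s j)%g.
Proof.
move=> ij jn; have fixj l : l.+1 < j -> (s j ^ s l = s j)%g.
  by move=> lj; apply/conjg_fixP/commgP; symmetry; apply: adjC.
by rewrite conjMg -adj_conj ?conjgM ?fixj //; lia.
Qed.

End AdjacentTranspositions.

Local Open Scope ring_scope.

(** * The Clifford algebra *)

Section SymDiff.
Variable N : nat.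
Implicit Types S T U : {set 'I_N}.

Lemma in_symdiff S T i : (i \in symdiff S T) = (i \in S) (+) (i \in T).
Proof. by rewrite !inE; case: (i \in S); case: (i \in T). Qed.

Lemma symdiffA S T U : symdiff S (symdiff T U) = symdiff (symdiff S T) U.
Proof. by apply/setP => i; rewrite !in_symdiff addbA. Qed.

Lemma symdiffC S T : symdiff S T = symdiff T S.
Proof. by apply/setP => i; rewrite !in_symdiff addbC. Qed.

Lemma symdiff0s S : symdiff set0 S = S.
Proof. by apply/setP => i; rewrite !in_symdiff inE. Qed.

Lemma symdiffs0 S : symdiff S set0 = S.
Proof. by rewrite symdiffC symdiff0s. Qed.

Lemma symdiffK S T : symdiff S (symdiff S T) = T.
Proof. by apply/setP => i; rewrite !in_symdiff addbA addbb. Qed.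

Lemma symdiff_eq S T U : (symdiff S T == U) = (T == symdiff S U).
Proof. by apply/eqP/eqP => [<-|->]; rewrite symdiffK. Qed.

Lemma symdiffs_bij S : bijective (symdiff S).
Proof. by exists (symdiff S); apply: symdiffK. Qed.

Lemma prod_symdiff (R : comPzRingType) (F : 'I_N -> R) S T :
  (forall i, F i * F i = 1) ->
  \prod_(i in symdiff S T) F i = \prod_(i in S) F i * \prod_(i in T) F i.
Proof.
move=> F2; rewrite (big_mkcond (mem (symdiff S T))) (big_mkcond (mem S)).
rewrite (big_mkcond (mem T)) -big_split /=.
apply: eq_bigr => i _; rewrite in_symdiff.
by case: (i \in S); case: (i \in T); rewrite /= ?mul1r ?mulr1 ?F2.
Qed.

Variable R : comPzRingType.

(** The pairs j < i and the common elements j = i merge into the single condition j <= i. In this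
    form the sign is visibly bimultiplicative for the symmetric difference. *)
Lemma clsignE S T :
  clsign R S T = \prod_(i in S) \prod_(j in T) (-1) ^+ (j <= i)%N.
Proof.
have E : clsign R S T =
    (-1) ^+ #|[set p : 'I_N * 'I_N | [&& p.1 \in S, p.2 \in T & (p.2 <= p.1)%N]]|.
  rewrite /clsign; congr (_ ^+ _).
  pose D := [set p : 'I_N * 'I_N | [&& p.1 \in S, p.2 \in T & (p.1 == p.2)]].
  have -> : #|S :&: T| = #|D|.
    rewrite -(card_imset (S :&: T) (f := fun i : 'I_N => (i, i))); last by move=> i j [].
    apply: eq_card => -[i j]; rewrite !inE /=; apply/imsetP/and3P.
      by case=> l; rewrite inE => /andP[lS lT] [-> ->].
    by case=> iS jT /eqP e; exists i => //; rewrite ?inE ?iS e ?jT.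
  rewrite -cardsUI.
  have -> : #|[set p | (p.1 \in S) && (p.2 \in T) && (p.2 < p.1)%N] :&: D| = 0%N.
    apply: eq_card0 => -[i j]; rewrite !inE /=.
    by case: eqP => [->|_]; rewrite ?ltnn ?andbF.
  rewrite addn0; apply: eq_card => -[i j]; rewrite !inE /= (leq_eqVlt j i) -val_eqE eq_sym.
  by case: (i \in S); case: (j \in T); rewrite /= ?orbF // orbC.
rewrite E pair_big /= -prodr_const big_mkcond [RHS]big_mkcond /=.
apply: eq_bigr => -[i j] _; rewrite !inE /=.
by case: (i \in S); case: (j \in T); case: (j <= i)%N.
Qed.

Lemma clsignDl S T U : clsign R (symdiff S T) U = clsign R S U * clsign R T U.
Proof.
rewrite !clsignE prod_symdiff // => i; rewrite -big_split big1 // => j _ /=.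
by rewrite -expr2 sqrr_sign.
Qed.

Lemma clsignDr S T U : clsign R S (symdiff T U) = clsign R S T * clsign R S U.
Proof.
rewrite !clsignE -big_split; apply: eq_bigr => i _ /=.
by rewrite prod_symdiff // => j; rewrite -expr2 sqrr_sign.
Qed.

Lemma clsign0s S : clsign R set0 S = 1.
Proof. by rewrite clsignE big_set0. Qed.

Lemma clsigns0 S : clsign R S set0 = 1.
Proof. by rewrite clsignE big1 // => i _; rewrite big_set0. Qed.

Lemma clsign11 (i j : 'I_N) : clsign R [set i] [set j] = (-1) ^+ (j <= i)%N.
Proof. by rewrite clsignE !big_set1. Qed.

Lemma sign_symdiff S T : (-1) ^+ #|symdiff S T| = (-1) ^+ #|S| * (-1) ^+ #|T| :> R.
Proof.
rewrite -!prodr_const.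
by rewrite -prod_symdiff // => i; rewrite mulrNN mulr1.
Qed.
End SymDiff.

Section CliffordRing.
Variables (R : comNzRingType) (N : nat).

Lemma clmulE (x y : clif R N) U :
  clmul x y U = \sum_S clsign R S (symdiff S U) * x S * y (symdiff S U).
Proof.
rewrite ffunE; apply: eq_bigr => S _.
rewrite (big_pred1 (symdiff S U)) // => T.
by rewrite symdiff_eq.
Qed.

(** A bimultiplicative sign is a 2-cocycle on the group of subsets under symmetric difference, and
    the twisted group algebra of a cocycle is associative. *)
Lemma clmulA : associative (@clmul R N).
Proof.
move=> x y z; apply/ffunP => U; rewrite !clmulE.
under eq_bigr => S _.
  rewrite clmulE mulr_sumr.
  rewrite (reindex (symdiff S)) /=; last exact/onW_bij/symdiffs_bij.
  over.
rewrite exchange_big /=; apply: eq_bigr => P _.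
rewrite clmulE mulr_sumr mulr_suml; apply: eq_bigr => S _.
have -> : symdiff (symdiff S P) (symdiff S U) = symdiff P U.
  by rewrite symdiffA [symdiff (symdiff S P) S]symdiffC symdiffK.
have -> : clsign R S (symdiff S P) = clsign R S (symdiff S U) * clsign R S (symdiff P U).
  rewrite -clsignDr -symdiffA; congr (clsign _ _ (symdiff _ _)).
  by rewrite [symdiff P U]symdiffC symdiffK.
rewrite clsignDl; ring.

Qed.

Lemma clmul1l : left_id (clone R N) (@clmul R N).
Proof.
move=> x; apply/ffunP => U; rewrite clmulE (bigD1 set0) //= big1 => [|S /negbTE S0].
  by rewrite addr0 ffunE eqxx clsign0s symdiff0s !mul1r.
by rewrite ffunE S0 mulr0 mul0r.
Qed.

Lemma clmul1r : right_id (clone R N) (@clmul R N).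
Proof.
move=> x; apply/ffunP => U; rewrite clmulE (bigD1 U) //= big1 => [|S SU].
  rewrite addr0 ffunE symdiff_eq symdiffs0 eqxx mulr1.
  by have /eqP-> : symdiff U U == set0; rewrite ?symdiff_eq ?symdiffs0 ?clsigns0 ?mul1r.
by rewrite !ffunE symdiff_eq symdiffs0 eq_sym (negbTE SU) mulr0.
Qed.

Lemma clmulDl : left_distributive (@clmul R N) +%R.
Proof.
move=> x y z; apply/ffunP => U; rewrite !ffunE -big_split; apply: eq_bigr => S _ /=.
by rewrite -big_split; apply: eq_bigr => T _; rewrite !ffunE mulrDr mulrDl.
Qed.

Lemma clmulDr : right_distributive (@clmul R N) +%R.
Proof.
move=> x y z; apply/ffunP => U; rewrite !ffunE -big_split; apply: eq_bigr => S _ /=.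
by rewrite -big_split; apply: eq_bigr => T _; rewrite !ffunE mulrDr.
Qed.

Lemma clone_neq0 : clone R N != 0.
Proof. by apply/eqP => /ffunP /(_ set0); rewrite !ffunE eqxx; apply/eqP/oner_neq0. Qed.

Lemma clscaleAl (a : R) (x y : {ffun {set 'I_N} -> R^o}) :
  a *: (clmul x y : {ffun {set 'I_N} -> R^o}) = clmul (a *: x) y.
Proof.
apply/ffunP => U; rewrite !ffunE scaler_sumr; apply: eq_bigr => S _.
rewrite scaler_sumr; apply: eq_bigr => T _; rewrite !ffunE /GRing.scale /=; ring.
Qed.

Lemma clscaleAr (a : R) (x y : {ffun {set 'I_N} -> R^o}) :
  a *: (clmul x y : {ffun {set 'I_N} -> R^o}) = clmul x (a *: y).
Proof.
apply/ffunP => U; rewrite !ffunE scaler_sumr; apply: eq_bigr => S _.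
rewrite scaler_sumr; apply: eq_bigr => T _; rewrite !ffunE /GRing.scale /=; ring.
Qed.

End CliffordRing.

(* A separate type: [clif] itself unfolds to a type of finite functions, on *)
(* which the product would be inferred to be the pointwise one.             *)
Definition cliff (R : comNzRingType) (N : nat) : Type := clif R N.

HB.instance Definition _ (R : comNzRingType) (N : nat) :=
  GRing.Lmodule.copy (cliff R N) {ffun {set 'I_N} -> R^o}.
HB.instance Definition _ (R : comNzRingType) (N : nat) :=
  GRing.Zmodule_isNzRing.Build (cliff R N) (@clmulA R N) (@clmul1l R N) (@clmul1r R N)
    (@clmulDl R N) (@clmulDr R N) (@clone_neq0 R N).
HB.instance Definition _ (R : comNzRingType) (N : nat) :=
  GRing.Lmodule_isLalgebra.Build R (cliff R N) (@clscaleAl R N).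
HB.instance Definition _ (R : comNzRingType) (N : nat) :=
  GRing.Lalgebra_isAlgebra.Build R (cliff R N) (@clscaleAr R N).

Section Vectors.
Variables (R : comNzRingType) (N : nat).
Implicit Types (x y : cliff R N) (v w : 'cV[R]_N) (i j : 'I_N).

Definition vec v : cliff R N := clvec v.
Definition alpha x : cliff R N := clalpha x.
Definition egen i : cliff R N := [ffun U : {set 'I_N} => (U == [set i])%:R].
Definition dotv v w : R := \sum_i v i 0 * w i 0.

Lemma cliffM x y : clmul x y = x * y. Proof. by []. Qed.

Lemma cliffD_coef x y U : (x + y) U = x U + y U.
Proof. by rewrite ffunE. Qed.
Lemma cliffZ_coef a x U : (a *: x) U = a * x U.
Proof. by rewrite ffunE. Qed.
Lemma cliff_sum_coef I (r : seq I) (P : pred I) (F : I -> cliff R N) U :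
  (\sum_(i <- r | P i) F i) U = \sum_(i <- r | P i) F i U.
Proof.
pose coefD x y := cliffD_coef x y U.
by rewrite (big_morph (fun x : cliff R N => x U) coefD (ffunE _ _)).
Qed.
Lemma cliff1_coef U : (1 : cliff R N) U = (U == set0)%:R.
Proof. by rewrite ffunE. Qed.

Lemma dotvE v w : (v^T *m w) 0 0 = dotv v w.
Proof. by rewrite mxE; apply: eq_bigr => i _; rewrite mxE. Qed.

Lemma vecE v : vec v = \sum_i v i 0 *: egen i.
Proof.
apply/ffunP => U; rewrite cliff_sum_coef ffunE big_mkcond; apply: eq_bigr => i _.
by rewrite cliffZ_coef ffunE; case: eqP => _; rewrite ?mulr1 ?mulr0.
Qed.

Lemma vec_is_linear : linear vec.
Proof.
move=> a v w; rewrite !vecE scaler_sumr -big_split; apply: eq_bigr => i _ /=.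
by rewrite !mxE scalerDl scalerA.
Qed.
HB.instance Definition _ :=
  GRing.isLinear.Build R 'cV[R]_N (cliff R N) *:%R vec vec_is_linear.

Lemma vec_delta i : vec (delta_mx i 0) = egen i.
Proof.
rewrite vecE (bigD1 i) //= big1 => [|j ji]; first by rewrite mxE !eqxx scale1r addr0.
by rewrite mxE (negbTE ji) scale0r.
Qed.

Lemma egenM_coef i x U :
  (egen i * x) U = clsign R [set i] (symdiff [set i] U) * x (symdiff [set i] U).
Proof.
rewrite -cliffM clmulE (bigD1 [set i]) //= big1 => [|S Si].
  by rewrite ffunE eqxx mulr1 addr0.
by rewrite ffunE (negbTE Si) mulr0 mul0r.
Qed.

Lemma Megen_coef i x U :
  (x * egen i) U = clsign R (symdiff [set i] U) [set i] * x (symdiff [set i] U).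
Proof.
have e : symdiff (symdiff [set i] U) U = [set i].
  by rewrite symdiffC [symdiff [set i] U]symdiffC symdiffK.
rewrite -cliffM clmulE (bigD1 (symdiff [set i] U)) //= big1 => [|S Si].
  by rewrite ffunE e eqxx mulr1 addr0.
rewrite [egen i _]ffunE (_ : (_ == [set i]) = false) ?mulr0 //.
apply: contraNF Si => /eqP; rewrite symdiffC => <-.
by rewrite -symdiffA [symdiff S U]symdiffC symdiffK.
Qed.

Lemma egen_anticomm i j : egen i * egen j + egen j * egen i = (- 2 * (i == j)%:R) *: 1.
Proof.
apply/ffunP => U; rewrite cliffD_coef cliffZ_coef cliff1_coef egenM_coef Megen_coef ffunE.
rewrite -mulrDl.
have [e|ne] := eqVneq (symdiff [set i] U) [set j].
  rewrite e !clsign11 mulr1; have [ij|ij] := eqVneq i j.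
    have /eqP := e; rewrite symdiff_eq ij => /eqP ->.
    have /eqP-> : symdiff [set j] [set j] == set0 by rewrite symdiff_eq symdiffs0.
    by rewrite leqnn eqxx /=; ring.
  rewrite mulr0 mul0r; case: ltngtP => [_|_|/val_inj ji] /=; try ring.
  by rewrite ji eqxx in ij.
rewrite mulr0; have [ij|_] := eqVneq i j; last by rewrite mulr0 mul0r.
rewrite (_ : U == set0 = false) ?mulr0 //; apply: contra_neqF ne => /eqP ->.
by rewrite symdiffs0 ij.
Qed.

Lemma vecM v w : vec v * vec w = \sum_i \sum_j (v i 0 * w j 0) *: (egen i * egen j).
Proof.
rewrite [vec v]vecE mulr_suml; apply: eq_bigr => i _.
rewrite vecE mulr_sumr; apply: eq_bigr => j _.
by rewrite -scalerAl -scalerAr scalerA.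
Qed.

Lemma vec_anticomm v w : vec v * vec w + vec w * vec v = (- 2 * dotv v w) *: 1.
Proof.
rewrite !vecM [X in _ + X]exchange_big -big_split /dotv mulr_sumr scaler_suml /=.
apply: eq_bigr => i _; rewrite -big_split (bigD1 i) //= big1 => [|j ji].
  by rewrite [w i 0 * _]mulrC -scalerDr egen_anticomm eqxx mulr1 scalerA addr0 mulrC.
by rewrite [w j 0 * _]mulrC -scalerDr egen_anticomm eq_sym (negbTE ji) mulr0 scale0r scaler0.
Qed.

Lemma alpha1 : alpha 1 = 1.
Proof.
apply/ffunP => U; rewrite ffunE cliff1_coef; case: eqP => [->|_]; last by rewrite mulr0.
by rewrite cards0 mul1r.
Qed.

Lemma alphaM x y : alpha (x * y) = alpha x * alpha y.
Proof.
apply/ffunP => U; rewrite ffunE -!cliffM !clmulE mulr_sumr; apply: eq_bigr => S _.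
rewrite !ffunE (_ : (-1) ^+ #|U| = (-1) ^+ #|S| * (-1) ^+ #|symdiff S U| :> R); first by ring.
by rewrite -sign_symdiff symdiffK.
Qed.

Lemma alpha_vec v : alpha (vec v) = - vec v.
Proof.
apply/ffunP => U; rewrite ffunE -scaleN1r cliffZ_coef !ffunE !mulr_sumr.
by apply: eq_bigr => i /eqP ->; rewrite cards1.
Qed.

(** The Euclidean product for which the basis e_S is orthonormal. Left multiplication by a vector is
    skew for it, hence that by a unit vector is an isometry; this forces the scalars in Pin(V) to be
    1 or -1. *)
Definition cldot x y : R := \sum_U x U * y U.

Lemma cldot_egen i x y : cldot (egen i * x) y = - cldot x (egen i * y).
Proof.
rewrite /cldot (reindex (symdiff [set i])) /=; last exact/onW_bij/symdiffs_bij.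
rewrite -sumrN; apply: eq_bigr => U _; rewrite !egenM_coef symdiffK clsignDr clsign11 leqnn.
by ring.
Qed.

Lemma cldot_vec v x y : cldot (vec v * x) y = - cldot x (vec v * y).
Proof.
rewrite vecE !mulr_suml /cldot.
under eq_bigr => U _ do rewrite cliff_sum_coef mulr_suml.
under [in RHS]eq_bigr => U _ do rewrite cliff_sum_coef mulr_sumr.
rewrite exchange_big [in RHS]exchange_big -sumrN /=; apply: eq_bigr => i _.
transitivity (v i 0 * cldot (egen i * x) y).
  by rewrite /cldot mulr_sumr; apply: eq_bigr => U _; rewrite -scalerAl cliffZ_coef mulrA.
rewrite cldot_egen mulrN; congr (- _); rewrite /cldot mulr_sumr.
by apply: eq_bigr => U _; rewrite -scalerAl cliffZ_coef mulrCA.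
Qed.

Lemma cldotZr a x y : cldot x (a *: y) = a * cldot x y.
Proof. by rewrite /cldot mulr_sumr; apply: eq_bigr => U _; rewrite cliffZ_coef mulrCA. Qed.

(** For i in S this says that alpha(e_S) e_i = - e_i e_S: each j in S other than i contributes 1,
    and i itself contributes -1. *)
Lemma clsign_swap i (S : {set 'I_N}) : i \in S ->
  (-1) ^+ #|S| * clsign R S [set i] * clsign R [set i] S = -1.
Proof.
move=> iS; rewrite !clsignE big_set1 -prodr_const.
under [X in _ * X * _]eq_bigr => j _ do rewrite big_set1.
rewrite -!big_split (bigD1 i) //= leqnn big1 => [|j /andP[_ ji]]; first by ring.
by case: ltngtP ji => [_ _|_ _|/val_inj ->] /=; rewrite ?eqxx //; ring.
Qed.

End Vectors.

Section RealClifford.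
Variables (R : realType) (N : nat).
Implicit Types (x y : cliff R N) (v w : 'cV[R]_N) (M : 'M[R]_N).

Lemma vec_sqr v : vec v * vec v = (- dotv v v) *: 1.
Proof.
have /eqP := vec_anticomm v v; rewrite -mulr2n -scaler_nat => /eqP E.
have n2 : (2 : R) != 0 by rewrite pnatr_eq0.
by apply: (scalerI n2); rewrite E scalerA; congr (_ *: _); ring.
Qed.

Lemma unitvecP v : reflect (dotv v v = 1) (unitvec v).
Proof. by rewrite /unitvec dotvE; apply: eqP. Qed.

Lemma vec_sqr1 v : unitvec v -> vec v * vec v = -1.
Proof. by move=> /unitvecP v1; rewrite vec_sqr v1 scaleN1r. Qed.

(** If i lies in S, comparing coefficients in the equation for e_i gives x_S = - x_S by
    [clsign_swap]; so only the empty set survives. *)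
Lemma twisted_center x : (forall w, alpha x * vec w = vec w * x) -> x = x set0 *: 1.
Proof.
move=> cx; apply/ffunP => S; rewrite cliffZ_coef cliff1_coef.
have [->|] := eqVneq S set0; first by rewrite mulr1.
case/set0Pn => i iS; rewrite mulr0.
have := cx (delta_mx i 0); rewrite vec_delta => /ffunP/(_ (symdiff [set i] S)).
rewrite egenM_coef Megen_coef symdiffK ffunE => E.
have : clsign R [set i] S * clsign R [set i] S * x S = - x S.
  have /(congr1 (fun z => z * x S)) := clsign_swap R iS; rewrite mulN1r => <-.
  by rewrite -[LHS]mulrA -E; ring.
have -> : clsign R [set i] S * clsign R [set i] S = 1.
  rewrite -clsignDr (_ : symdiff S S = set0) ?clsigns0 //.
  by apply/eqP; rewrite symdiff_eq symdiffs0.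
by lra.
Qed.

Definition vprod (vs : seq 'cV[R]_N) : cliff R N := \prod_(v <- vs) vec v.

Lemma PinP x : Pin x <-> exists2 vs, all (@unitvec R N) vs & x = vprod vs.
Proof.
have E vs : foldr (fun v acc => clmul (clvec v) acc) (clone R N) vs = vprod vs.
  by rewrite /vprod unlock; elim: vs => //= v vs ->.
by split=> [[vs [/allP H ->]]|[vs /allP H ->]]; exists vs; rewrite ?E.
Qed.

Lemma Pin1 : Pin (1 : cliff R N).
Proof. by apply/PinP; exists [::]; rewrite /vprod ?big_nil. Qed.

Lemma PinM x y : Pin x -> Pin y -> Pin (x * y).
Proof.
move=> /PinP[vs Hv ->] /PinP[ws Hw ->]; apply/PinP; exists (vs ++ ws).
  by rewrite all_cat Hv Hw.
by rewrite /vprod big_cat.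
Qed.

Lemma Pin_vec v : unitvec v -> Pin (vec v).
Proof. by move=> uv; apply/PinP; exists [:: v]; rewrite /vprod ?big_seq1 //= uv. Qed.

Lemma cldot_vprod vs : all (@unitvec R N) vs -> cldot (vprod vs) (vprod vs) = 1.
Proof.
elim: vs => [|v vs IH] /=.
  rewrite /vprod big_nil /cldot (bigD1 set0) //= big1 => [|U U0].
    by rewrite !cliff1_coef eqxx mulr1 addr0.
  by rewrite !cliff1_coef (negbTE U0) mulr0.
case/andP => uv /IH E; rewrite /vprod big_cons -/(vprod vs) cldot_vec mulrA vec_sqr1 //.
by rewrite mulN1r -scaleN1r cldotZr E mulN1r opprK.
Qed.

Lemma Pin_scalar (c : R) : Pin (c *: 1 : cliff R N) -> c = 1 \/ c = -1.
Proof.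
move=> /PinP[vs uvs E]; have := cldot_vprod uvs.
rewrite -E /cldot (bigD1 set0) //= big1 => [|U U0].
  rewrite !cliffZ_coef cliff1_coef eqxx mulr1 addr0 => /eqP.
  by rewrite -expr2 sqrf_eq1 => /orP[] /eqP; [left|right].
by rewrite !cliffZ_coef cliff1_coef (negbTE U0) mulr0 mulr0.
Qed.

Lemma rho_isP x M : rho_is x M <-> forall w, alpha x * vec w = vec (M *m w) * x.
Proof. by []. Qed.

Lemma rho_is1 : rho_is (1 : cliff R N) 1%:M.
Proof. by apply/rho_isP => w; rewrite alpha1 mul1mx mul1r mulr1. Qed.

Lemma rho_isM x y M M' : rho_is x M -> rho_is y M' -> rho_is (x * y) (M *m M').
Proof.
move=> /rho_isP Hx /rho_isP Hy; apply/rho_isP => w.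
by rewrite alphaM -mulrA Hy mulrA Hx -mulmxA mulrA.
Qed.

Lemma rho_isV x y M M' : x * y = 1 -> y * x = 1 -> M *m M' = 1%:M ->
  rho_is x M -> rho_is y M'.
Proof.
move=> xy yx MM' /rho_isP Hx; apply/rho_isP => w.
have E := Hx (M' *m w); rewrite mulmxA MM' mul1mx in E.
by rewrite -[LHS]mulr1 -xy !mulrA -(mulrA (alpha y) _ x) -E mulrA -alphaM yx alpha1 mul1r.
Qed.

Lemma Pin_inv x : Pin x -> exists2 y : cliff R N, Pin y & x * y = 1 /\ y * x = 1.
Proof.
move=> /PinP[vs + ->]; elim: vs => [_|v vs IH] /=.
  by exists 1; rewrite /vprod ?big_nil ?mulr1 //; apply: Pin1.
case/andP => uv /IH[y Py [xy yx]]; exists (y * - vec v).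
  apply: PinM => //; rewrite -linearN; apply: Pin_vec.
  by rewrite /unitvec mulmxN (linearN trmx) /= mulNmx opprK.
have e1 : vec v * - vec v = 1 by rewrite mulrN vec_sqr1 // opprK.
have e2 : - vec v * vec v = 1 by rewrite mulNr vec_sqr1 // opprK.
rewrite /vprod big_cons -/(vprod vs); split.
  by rewrite mulrA -[_ * _ * y]mulrA xy mulr1.
by rewrite mulrA -[y * _ * _]mulrA e2 mulr1.
Qed.

(** The quotient of two lifts lies over the identity, so it is a scalar by [twisted_center], and
    [Pin_scalar] leaves only 1 and -1. *)
Lemma lift_unique x y M : orthogonal_mx M -> Pin x -> Pin y ->
  rho_is x M -> rho_is y M -> x = y \/ x = - y.
Proof.
move=> oM Px Py rx ry; have [z Pz [yz zy]] := Pin_inv Py.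
have rz := rho_isV yz zy oM ry.
have := rho_isM rx rz; rewrite oM => /rho_isP H.
have E : x * z = (x * z) set0 *: 1.
  by apply: twisted_center => w; rewrite H mul1mx.
have Pc : Pin ((x * z) set0 *: 1 : cliff R N) by rewrite -E; apply: PinM.
have xE : x = x * z * y by rewrite -mulrA zy mulr1.
rewrite xE E -scalerAl mul1r.
by case: (Pin_scalar Pc) => ->; rewrite ?scale1r ?scaleN1r; [left|right].
Qed.

Lemma dotvC v w : dotv v w = dotv w v.
Proof. by apply: eq_bigr => i _; rewrite mulrC. Qed.

Lemma dotv_is_linear u : linear (dotv u : 'cV[R]_N -> R^o).
Proof. by move=> a v w; rewrite -!dotvE mulmxDr -scalemxAr !mxE. Qed.
HB.instance Definition _ u :=
  GRing.isLinear.Build R 'cV[R]_N R^o *:%R (dotv u) (dotv_is_linear u).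

Lemma dotvBr u v w : dotv u (v - w) = dotv u v - dotv u w.
Proof. exact: linearB. Qed.
Lemma dotvNr u v : dotv u (- v) = - dotv u v.
Proof. exact: linearN. Qed.
Lemma dotvZr a u v : dotv u (a *: v) = a * dotv u v.
Proof. exact: linearZ. Qed.

Lemma dotv_orth M v w : orthogonal_mx M -> dotv (M *m v) (M *m w) = dotv v w.
Proof.
by move=> /mulmx1C MM; rewrite -!dotvE trmx_mul mulmxA -[v^T *m _ *m _]mulmxA MM mulmx1.
Qed.

Lemma dotv_gt0 v : v != 0 -> 0 < dotv v v.
Proof.
move=> v0; rewrite lt_def /dotv sumr_ge0 ?andbT => [|i _]; last by rewrite -expr2 sqr_ge0.
apply: contraNneq v0 => /psumr_eq0P v0; apply/eqP/colP => i; rewrite mxE.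
have /eqP := v0 (fun i _ => sqr_ge0 (v i 0)) i isT.
by rewrite mulf_eq0 orbb => /eqP.
Qed.

Definition refl v : 'M[R]_N := 1%:M - 2 *: (v *m v^T).

Lemma refl_mulmx v w : refl v *m w = w - (2 * dotv v w) *: v.
Proof.
rewrite mulmxBl mul1mx -scalemxAl -mulmxA [v^T *m w]mx11_scalar dotvE.
by rewrite mul_mx_scalar scalerA.
Qed.

Lemma tr_refl v : (refl v)^T = refl v.
Proof. by rewrite /refl linearB /= trmx1 linearZ /= trmx_mul trmxK. Qed.

Lemma reflK v : unitvec v -> refl v *m refl v = 1%:M.
Proof.
move=> /unitvecP v1; rewrite {2}/refl mulmxBr mulmx1 -scalemxAr mulmxA refl_mulmx v1.
rewrite mulr1 scaler_nat mulr2n opprD addrA subrr sub0r mulNmx scalerN opprK.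
by rewrite /refl subrK.
Qed.

Lemma refl_orth v : unitvec v -> orthogonal_mx (refl v).
Proof. by move=> uv; rewrite /orthogonal_mx tr_refl reflK. Qed.

Lemma rho_vec v : unitvec v -> rho_is (vec v) (refl v).
Proof.
move=> uv; apply/rho_isP => w; rewrite alpha_vec refl_mulmx linearB linearZ /= mulrBl.
have E : vec v * vec w = (- 2 * dotv v w) *: 1 - vec w * vec v.
  by rewrite -vec_anticomm addrK.
by rewrite -scalerAl vec_sqr1 // scalerN opprK mulNr E opprB mulNr scaleNr opprK.
Qed.

Lemma orth_mulmx M M' : orthogonal_mx M -> orthogonal_mx M' -> orthogonal_mx (M *m M').
Proof.
by rewrite /orthogonal_mx => oM oM'; rewrite trmx_mul -mulmxA (mulmxA M') oM' mul1mx.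
Qed.

(** The induction measure for splitting off reflections. *)
Definition moved M : nat := #|[pred i | M *m delta_mx i 0 != delta_mx i 0 :> 'cV_N]|.

(* [v] is the normalisation of [u = M e_i - e_i] for a basis vector [e_i] that *)
(* [M] moves. As [|M e_i| = |e_i|], the reflection in [v] sends [M e_i] to     *)
(* [e_i]; as [u] is orthogonal to every vector fixed by [M], these stay fixed. *)
Lemma householder M : orthogonal_mx M -> M != 1%:M ->
  exists v, [/\ unitvec v, (moved (refl v *m M) < moved M)%N &
                M *m M = 1%:M -> M *m v = - v].
Proof.
move=> oM M1; pose e (i : 'I_N) : 'cV[R]_N := delta_mx i 0.
have [i Mi] : exists i, M *m e i != e i.
  apply/existsP; apply: contraNT M1; rewrite negb_exists => /forallP H.
  apply/eqP/matrixP => j i; have /negPn/eqP/matrixP/(_ j 0) := H i.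
  by rewrite -colE !mxE eqxx andbT.
pose u := M *m e i - e i; have u0 : u != 0 by rewrite subr_eq0.
have c0 := dotv_gt0 u0; set c := dotv u u in c0.
pose a := (Num.sqrt c)^-1; pose v := a *: u.
have a2 : a * a = c^-1 by rewrite -invfM -expr2 sqr_sqrtr // ltW.
have uv : unitvec v.
  by apply/unitvecP; rewrite dotvZr dotvC dotvZr mulrA a2 mulVf // gt_eqF.
have reflE w : refl v *m w = w - (2 * dotv u w / c) *: u.
  rewrite refl_mulmx /v dotvC dotvZr scalerA dotvC; congr (_ - _ *: _).
  by rewrite -a2; ring.
have uE w : M *m w = w -> dotv u w = 0.
  by move=> fixw; rewrite dotvC dotvBr -[X in dotv X _]fixw dotv_orth // subrr.
have fx w : M *m w = w -> refl v *m (M *m w) = w.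
  by move=> Mw; rewrite Mw reflE uE // mulr0 mul0r scale0r subr0.
have fi : refl v *m (M *m e i) = e i.
  have cE : c = 2 * dotv u (M *m e i).
    rewrite /c {2}/u dotvBr [dotv u (e i)]dotvC [dotv u (M *m _)]dotvC /u !dotvBr.
    by rewrite dotv_orth // [dotv (e i) (M *m _)]dotvC; ring.
  by rewrite reflE -cE divff ?gt_eqF // scale1r /u opprB addrC subrK.
exists v; split=> // [|MM].
  apply/proper_card/properP; split.
    apply/subsetP => j; rewrite !inE; apply: contra => /eqP /fx.
    by rewrite mulmxA => ->.
  by exists i; rewrite !inE // negbK -mulmxA fi.
by rewrite /v -scalemxAr /u mulmxBr mulmxA MM mul1mx -scalerN opprB.
Qed.

End RealClifford.

(** * Lifts of orthogonal matrices *)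

(** The matrix determinant lemma: one block matrix is factored in two ways, by eliminating either
    diagonal block. *)
Lemma det_1B_mulmx (R : comNzRingType) (N : nat) (a : 'cV[R]_N) (b : 'rV[R]_N) :
  \det (1%:M - a *m b) = 1 - (b *m a) 0 0.
Proof.
have e1 : block_mx (1%:M : 'M_1) b a (1%:M : 'M_N) =
    block_mx 1%:M 0 a 1%:M *m block_mx 1%:M b 0 (1%:M - a *m b).
  by rewrite mulmx_block !mul1mx !mul0mx !mulmx1 ?mulmx0 ?addr0 addrC subrK.
have e2 : block_mx (1%:M : 'M_1) b a (1%:M : 'M_N) =
    block_mx (1%:M - b *m a) b 0 1%:M *m block_mx 1%:M 0 a 1%:M.
  by rewrite mulmx_block !mul1mx !mul0mx !mulmx1 ?mulmx0 ?add0r subrK.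
have := congr1 (@determinant _ _) e1; rewrite e2 !det_mulmx !det_ublock !det_lblock.
by rewrite !det1 !mulr1 !mul1r det_mx11 !mxE /= => <-.
Qed.

Section Lifts.
Variables (R : realType) (N : nat).
Implicit Types (x y : cliff R N) (v w : 'cV[R]_N) (M : 'M[R]_N).

Lemma det_refl v : unitvec v -> \det (refl v) = -1.
Proof.
move=> /unitvecP v1; rewrite /refl scalemxAl det_1B_mulmx -scalemxAr mxE dotvE v1.
by ring.
Qed.

(** Surjectivity of rho, in the manner of Cartan and Dieudonne: [householder] splits off one
    reflection at a time, and each reflection lifts to its unit vector. *)
Lemma orth_lift M : orthogonal_mx M -> exists2 x : cliff R N, Pin x & rho_is x M.
Proof.
have [m] := ubnP (moved M); elim: m M => // m IH M le_m oM.
have [->|M1] := eqVneq M 1%:M; first by exists 1; [apply: Pin1|apply: rho_is1].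
have [v [uv lt_v _]] := householder oM M1.
have [||x Px rx] := IH (refl v *m M); first by apply: leq_trans lt_v _.
  by apply: orth_mulmx => //; apply: refl_orth.
exists (vec v * x); first by apply: PinM => //; apply: Pin_vec.
by have := rho_isM (rho_vec uv) rx; rewrite mulmxA reflK // mul1mx.
Qed.

Lemma vec_vprod_comm v vs : {in vs, forall w, dotv v w = 0} ->
  vec v * vprod vs = (-1) ^+ size vs * (vprod vs * vec v).
Proof.
elim: vs => [|w vs IH] vw; first by rewrite /vprod big_nil mulr1 !mul1r.
have E : vec v * vec w = - (vec w * vec v).
  apply/eqP; rewrite -addr_eq0 vec_anticomm vw ?mem_head // mulr0 scale0r //.
rewrite /vprod big_cons -/(vprod vs) (mulrA (vec v)) E mulNr.
rewrite -(mulrA (vec w) (vec v)) IH => [|z zs]; last first.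
  by rewrite vw // inE zs orbT.
by rewrite exprS mulN1r mulNr; congr (- _); rewrite !mulrA commr_sign.
Qed.

(* The [v]s are an orthonormal basis of the (-1)-eigenspace of [M]. *)
Lemma involution_prod M : orthogonal_mx M -> M *m M = 1%:M ->
  exists vs, [/\ all (@unitvec R N) vs, {in vs, forall v, M *m v = - v},
    rho_is (vprod vs) M,
    vprod vs * vprod vs = (-1) ^+ 'C((size vs).+1, 2) &
    \tr M = N%:R - (2 * size vs)%:R /\ \det M = (-1) ^+ size vs].
Proof.
have [m] := ubnP (moved M); elim: m M => // m IH M le_m oM MM.
have [->|M1] := eqVneq M 1%:M.
  exists [::]; rewrite /vprod big_nil mxtrace1 det1 muln0 subr0 mulr1 expr0.
  by split=> //; apply: rho_is1.
have [v [uv lt_v /(_ MM) Mv]] := householder oM M1.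
have MT : M^T = M by rewrite -[LHS]mul1mx -MM -mulmxA oM mulmx1.
(* As [v] is an eigenvector of the symmetric matrix [M], the reflection in [v] commutes with [M], so
   [refl v *m M] is again an involution. *)
have cvM : refl v *m M = M *m refl v.
  rewrite mulmxBl mulmxBr mul1mx mulmx1 -scalemxAl -scalemxAr mulmxA Mv.
  by rewrite -mulmxA -{2}MT -trmx_mul Mv linearN /= mulmxN mulNmx.
have rM : refl v *m M = M + 2 *: (v *m v^T).
  by rewrite cvM mulmxBr mulmx1 -scalemxAr mulmxA Mv mulNmx scalerN opprK.
have [|||vs [uvs Mvs rvs sqr_vs [tr_vs det_vs]]] := IH (refl v *m M).
- by apply: leq_trans lt_v _.
- by apply: orth_mulmx => //; apply: refl_orth.
- by rewrite {1}cvM mulmxA -(mulmxA M) reflK // mulmx1.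
(* [refl v *m M] is orthogonal, fixes [v] and negates every vector of [vs]; eigenvectors for
   distinct eigenvalues are orthogonal. *)
have ortho : {in vs, forall w, dotv v w = 0}.
  move=> w /Mvs Mw; have := dotv_orth v w (orth_mulmx (refl_orth uv) oM).
  rewrite Mw -mulmxA Mv mulmxN refl_mulmx; have /unitvecP -> := uv.
  rewrite mulr1 scaler_nat mulr2n opprB addrK dotvNr; lra.
exists (v :: vs); split=> /=.
- by rewrite uv.
- move=> w; rewrite inE => /predU1P[-> //|ws].
  have := Mvs w ws; rewrite rM mulmxDl -scalemxAl -mulmxA [v^T *m w]mx11_scalar dotvE ortho //.
  by rewrite mul_mx_scalar scale0r scaler0 addr0.
- rewrite /vprod big_cons -/(vprod vs).
  by have := rho_isM (rho_vec uv) rvs; rewrite mulmxA reflK // mul1mx.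
(* Moving [v] past [vs] costs the sign (-1)^(size vs) and v^2 = -1; these account for C(m+2,2) =
   C(m+1,2) + m + 1, where m is the size of [vs]. *)
- rewrite /vprod big_cons -/(vprod vs) -mulrA [vprod vs * (_ * _)]mulrA.
  have -> : vprod vs * vec v = (-1) ^+ size vs * (vec v * vprod vs).
    by rewrite vec_vprod_comm // mulrA -exprD -signr_odd addnn odd_double mul1r.
  rewrite binS bin1 exprD -sqr_vs exprSr mulrN1 mulrN.
  rewrite -2!mulrA (mulrA (vec v) (_ ^+ _)) (commr_sign (vec v)).
  by rewrite -(mulrA (_ ^+ _)) (mulrA (vec v) (vec v)) vec_sqr1 // mulN1r mulrN commr_sign.
- move: tr_vs; rewrite rM linearD linearZ /= mxtrace_mulC trace_mx11 dotvE.
  have /unitvecP -> := uv; rewrite natrM natrM -natr1 => E; split; first by lra.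
  have -> : \det M = \det (refl v) * \det (refl v *m M).
    by rewrite -det_mulmx mulmxA reflK // mul1mx.
  by rewrite det_vs det_refl // exprS.
Qed.

(** Two lifts differ by a sign, which squaring removes, so the value found for the product of
    eigenvectors holds for every lift. *)
Lemma lift_involution M : orthogonal_mx M -> M *m M = 1%:M ->
  exists m : nat, [/\ \tr M = N%:R - (2 * m)%:R, \det M = (-1) ^+ m &
    forall x, Pin x -> rho_is x M -> x * x = (-1) ^+ 'C(m.+1, 2)].
Proof.
move=> oM MM; have [vs [uvs _ rvs sqr_vs [tr_vs det_vs]]] := involution_prod oM MM.
exists (size vs); split=> // x Px rx; rewrite -sqr_vs.
have Pvs : Pin (vprod vs) by apply/PinP; exists vs.
by case: (lift_unique oM Px Pvs rx rvs) => ->; rewrite ?mulrNN.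
Qed.

End Lifts.

(** * Representations of the symmetric and alternating groups *)

Section Numbers.
Variable R : realType.

Lemma odd_bin2 m : odd 'C(m.+1, 2) = odd (uphalf m).
Proof.
elim: m => // m IH; rewrite binS bin1 oddD IH /= uphalf_half !oddD oddb /=.
by case: (odd m); case: (odd _).
Qed.

Lemma cliff_sign1 N k : (-1) ^+ k = 1 :> cliff R N <-> ~~ odd k.
Proof.
rewrite -signr_odd; case: (odd k) => /=; last by split.
split=> // /ffunP/(_ set0).
by rewrite expr1 -scaleN1r cliffZ_coef !cliff1_coef eqxx mulr1 => /eqP; rewrite eqNr oner_eq0.
Qed.

(** The binomial m(m+1)/2 is even exactly when m is 0 or 3 modulo 4. *)
Lemma cliff_bin_sign1 N m :
  (-1) ^+ 'C(m.+1, 2) = 1 :> cliff R N <->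
  (2 * m = 0 %[mod 8] \/ 2 * m = 6 %[mod 8])%N.
Proof. by rewrite cliff_sign1 odd_bin2; lia. Qed.

(** Translates character congruences into congruences for m = 2 dim of the (-1)-eigenspace; r is 0
    or 6 in the applications. *)
Lemma congr_mod_natP (a t : R) (m r : nat) : t = a - m%:R ->
  congr_mod (a - r%:R) t 8 <-> m = r %[mod 8].
Proof.
move=> ->; rewrite /congr_mod.
have -> : a - r%:R - (a - m%:R) = (m%:Z - r%:Z)%:~R.
  by rewrite intrB -!pmulrn; ring.
split=> [[k /intr_inj]|E]; first by lia.
exists ((m %/ 8)%:Z - (r %/ 8)%:Z); congr (_%:~R).
by rewrite (divn_eq m 8) (divn_eq r 8) E; lia.
Qed.

Lemma sign_real1 m : (-1) ^+ m = 1 :> R -> ~~ odd m.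
Proof. by rewrite -signr_odd; case: (odd m) => // /eqP; rewrite expr1 eqNr oner_eq0. Qed.
End Numbers.

(** * Actions of S_n twisted by parity *)

Section TwistedAction.
Variables (C : nzRingType) (k : nat) (y y' : nat -> C).
Hypothesis yK : forall i, (i < k)%N -> y i * y' i = 1.
Hypothesis y'K : forall i, (i < k)%N -> y' i * y i = 1.
Hypothesis cube1 : forall i, (i.+1 < k)%N -> (y i * y' i.+1) ^+ 3 = 1.
Hypothesis sqr1 : forall i j, (i.+1 < j)%N -> (j < k)%N -> (y i * y' j) * (y i * y' j) = 1.

(** The flag makes factors [y] and [y'] alternate, so the Coxeter relations for [twist] become
    relations between the products y_i y'_j, which stand for the even elements s_i s_j. *)
Definition twist (i : nat) (p : C * bool) : C * bool :=
  (p.1 * (if p.2 then y' i else y i), ~~ p.2).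

Lemma mulKy i x : (i < k)%N -> x * y i * y' i = x.
Proof. by move=> ik; rewrite -mulrA yK // mulr1. Qed.

Lemma mulKy' i x : (i < k)%N -> x * y' i * y i = x.
Proof. by move=> ik; rewrite -mulrA y'K // mulr1. Qed.

Lemma twist_coxeter : coxeter_action k twist.
Proof.
split=> [i [x b] ik|i j [x b] ij jk|i [x b] ik]; rewrite /twist /= ?negbK.
- by case: b; rewrite ?mulKy ?mulKy'.
- have ik : (i < k)%N by apply: leq_ltn_trans jk; apply: ltnW (ltnW ij).
  (* The square relation, since [y j * y' i] is the inverse of [y i * y' j]. *)
  have E : y i * y' j = y j * y' i.
    by rewrite -[RHS]mul1r -(sqr1 ij jk) !mulrA mulKy' // mulKy.
  case: b; rewrite /= -!mulrA; last by rewrite E.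
  congr (_ * _, _).
  by rewrite -[LHS]mul1r -(y'K ik) -!mulrA (mulrA (y i)) E !mulrA mulKy'.
- have iltk : (i < k)%N by apply: ltnW.
  have E : y i * y' i.+1 * y i = y i.+1 * y' i * y i.+1.
    rewrite -[RHS]mul1r -(cube1 ik) !exprS expr0 mulr1 !mulrA.
    by rewrite mulKy' // mulKy // mulKy'.
  case: b; rewrite /= -!mulrA; congr (_ * _, _); rewrite !mulrA //.
  (* With the flag set the factors begin with [y'], and the braid relation needed is the inverse of
     [E]; the inserted factors multiply to 1 by [E]. *)
  have <- : y' i * y i.+1 * y' i * (y i * y' i.+1 * y i) * (y' i.+1 * y i * y' i.+1) =
            y' i * y i.+1 * y' i.
    by rewrite E !mulrA mulKy // mulKy' // mulKy.
  by rewrite !mulrA mulKy' // mulKy // y'K // mul1r.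
Qed.

End TwistedAction.

(** [Phi b g] is the first component of the image of (1, b) under g. The action commutes with left
    multiplication and shifts the flag by the parity of g, whence the cocycle rule; on even elements
    [Phi b] is multiplicative. *)
Lemma twisted_product (C : nzRingType) (n : nat) (y y' : nat -> C) : (0 < n)%N ->
  coxeter_action n.-1 (twist y y') ->
  exists Phi : bool -> 'S_n -> C,
  [/\ forall b, Phi b 1%g = 1,
      forall b g i, (i.+1 < n)%N ->
        Phi b (g * adj n i)%g = Phi b g * (if b (+) odd_perm g then y' i else y i) &
      forall b g h, Phi b (g * h)%g = Phi b g * Phi (b (+) odd_perm g) h].
Proof.
move=> n0 /(coxeter_action_perm n0) [act [act1 actM act_adj]].
have actE g x b : act g (x, b) = (x * (act g (1, b)).1, b (+) odd_perm g).
  elim/adj_ind: g x b => [|g i ik IH] x b; first by rewrite !act1 odd_perm1 addbF mulr1.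
  have := IH 1 b; rewrite mul1r !actM (IH x); case: (act g (1, b)) => q c [->].
  by rewrite !act_adj // /twist /= mulrA odd_permM odd_adj // addbT addbN.
exists (fun b g => (act g (1, b)).1); split=> [b|b g i ik|b g h].
- by rewrite act1.
- rewrite actM; have := actE g 1 b; rewrite mul1r => ->.
  by rewrite act_adj // /twist /=.
- rewrite actM; have := actE g 1 b; rewrite mul1r => ->.
  by rewrite actE /=.
Qed.

Section LiftSystem.
Variables (R : realType) (N : nat).

(** The signs are fixed one index at a time: changing the sign of the newest lift changes the sign
    of the only cube that involves both it and its predecessor. *)
Lemma lift_system (k : nat) (psi : nat -> 'M[R]_N) :
  (forall i, (i < k)%N -> orthogonal_mx (psi i)) ->
  (forall i, (i.+1 < k)%N ->
     let c := psi i *m (psi i.+1)^T in c *m (c *m c) = 1%:M) ->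
  exists y y' : nat -> cliff R N,
  [/\ forall i, (i < k)%N -> Pin (y i) /\ rho_is (y i) (psi i),
      forall i, (i < k)%N -> Pin (y' i) /\ rho_is (y' i) (psi i)^T,
      forall i, (i < k)%N -> y i * y' i = 1,
      forall i, (i < k)%N -> y' i * y i = 1 &
      forall i, (i.+1 < k)%N -> (y i * y' i.+1) ^+ 3 = 1].
Proof.
elim: k => [|k IH] opsi psi3; first by exists (fun=> 1), (fun=> 1); split.
have [|i ik|y [y' [Py Py' yy' y'y y3]]] := IH.
- by move=> i ik; apply: opsi; apply: ltnW.
- by apply: psi3; apply: ltnW.
have [z Pz rz] := orth_lift (opsi k (ltnSn k)).
have [z' Pz' [zz' z'z]] := Pin_inv Pz.
have rz' := rho_isV zz' z'z (opsi k (ltnSn k)) rz.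
pose c := y k.-1 * z'.
have [e [[Pe re e2 ec] ce]] : exists e : cliff R N, [/\ Pin e, rho_is e 1%:M, e * e = 1 &
    (0 < k)%N -> (c * e) ^+ 3 = 1] /\ forall x, e * x = x * e.
  case: (posnP k) => [k0|k0].
    exists 1; split=> [|x]; last by rewrite mulr1 mul1r.
    by split; rewrite ?mulr1 //; [apply: Pin1|apply: rho_is1].
  have km : (k.-1 < k)%N by rewrite prednK.
  have Pc : Pin c by apply: PinM => //; case: (Py _ km).
  have rc : rho_is c (psi k.-1 *m (psi k)^T) by apply: rho_isM => //; case: (Py _ km).
  have Pc3 : Pin (c ^+ 3) by rewrite !exprS expr0 mulr1; apply: PinM Pc (PinM Pc Pc).
  have rc3 : rho_is (c ^+ 3) 1%:M.
    have := psi3 k.-1; rewrite prednK // => /(_ (ltnSn k)) <-.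
    by rewrite !exprS expr0 mulr1; apply: rho_isM rc (rho_isM rc rc).
  have o1 : orthogonal_mx (1%:M : 'M[R]_N) by rewrite /orthogonal_mx trmx1 mulmx1.
  (* The cube lies over the identity, so it is 1 or -1, and it is itself the required correction: (c
     e)^3 = c^3 e^3 = e^4 = 1 for e = c^3. *)
  exists (c ^+ 3).
  have [E|E] := lift_unique o1 Pc3 (@Pin1 R N) rc3 (@rho_is1 R N).
    rewrite E; split=> [|x]; last by rewrite mulr1 mul1r.
    by split; rewrite ?mulr1 ?E //; [apply: Pin1|apply: rho_is1].
  rewrite E; split=> [|x]; last by rewrite mulrN1 mulN1r.
  by split; rewrite -?E // ?E ?mulrNN ?mulr1 // mulrN1 exprNn E -signr_odd expr1 mulrNN mulr1.
exists (fun i => if i == k then z * e else y i), (fun i => if i == k then e * z' else y' i).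
split=> i; rewrite ?ltnS.
- case: eqVneq => [->|ik] ik'; last by apply: Py; rewrite ltn_neqAle ik.
  by split; [apply: PinM|rewrite -[psi k]mulmx1; apply: rho_isM].
- case: eqVneq => [->|ik] ik'; last by apply: Py'; rewrite ltn_neqAle ik.
  by split; [apply: PinM|rewrite -[(psi k)^T]mul1mx; apply: rho_isM].
- case: eqVneq => [->|ik] ik'; last by apply: yy'; rewrite ltn_neqAle ik.
  by rewrite mulrA -(mulrA z) e2 mulr1.
- case: eqVneq => [->|ik] ik'; last by apply: y'y; rewrite ltn_neqAle ik.
  by rewrite mulrA -(mulrA e) z'z mulr1.
- move=> ik; rewrite ltn_eqF //; case: eqVneq => [ik'|ik']; last first.
    by apply: y3; rewrite ltn_neqAle ik'.
  have k0 : (0 < k)%N by rewrite -ik'.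
  by rewrite -(ec k0) /c -ik' /= ce mulrA.
Qed.

End LiftSystem.

(** * Orthogonal representations of a group between A_n and S_n *)

Section Representation.
Variables (R : realType) (n : nat) (G : {group 'S_n}) (N : nat).
Variable pi : mx_representation R G N.
Hypotheses (n4 : (4 <= n)%N) (AG : Alt 'I_n \subset G).
Hypothesis opi : {in G, forall g, orthogonal_mx (pi g)}.
Local Notation s := (adj n).

Lemma tr_pi g : g \in G -> (pi g)^T = pi (g^-1)%g.
Proof.
move=> gG; rewrite -[LHS]mul1mx -(repr_mx1 pi) -(mulVg g) repr_mxM ?groupV //.
by rewrite -mulmxA opi // mulmx1.
Qed.

Lemma trace_piJ g h : g \in G -> h \in G -> \tr (pi (g ^ h)%g) = \tr (pi g).
Proof.
move=> gG hG; rewrite conjgE !repr_mxM ?groupM ?groupV // mxtrace_mulC -mulmxA.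
by rewrite -repr_mxM ?groupV // mulgV repr_mx1 mulmx1.
Qed.

Lemma chi1 : chi pi 1%g = N%:R.
Proof. by rewrite /chi repr_mx1 mxtrace1. Qed.

Lemma pi_involution g : g \in G -> (g * g = 1)%g -> pi g *m pi g = 1%:M.
Proof. by move=> gG gg; rewrite -repr_mxM // gg repr_mx1. Qed.

Lemma spinorial_involution g : spinorial G pi -> g \in G -> (g * g = 1)%g ->
  exists m : nat, [/\ chi pi g = N%:R - (2 * m)%:R, \det (pi g) = (-1) ^+ m &
    (2 * m = 0 %[mod 8] \/ 2 * m = 6 %[mod 8])%N].
Proof.
move=> [ph [Pph phM rph]] gG gg.
have [m [tr_m det_m sqr_m]] := lift_involution (opi gG) (pi_involution gG gg).
exists m; split=> //; apply/(cliff_bin_sign1 R N).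
rewrite -(sqr_m _ (Pph g gG) (rph g gG)) -cliffM -phM // gg.
(* [spinorial] gives multiplicativity only; the lift of the identity is an invertible idempotent,
   hence 1. *)
have [z _ [zz _]] := Pin_inv (Pph _ (group1 G)).
have := phM _ _ (group1 G) (group1 G); rewrite mulg1 cliffM => /(congr1 ( *%R^~ z)).
by rewrite -mulrA zz mulr1.
Qed.

Lemma adj2_G i j : (i.+1 < n)%N -> (j.+1 < n)%N -> (s i * s j)%g \in G.
Proof. by move=> hi hj; apply: (subsetP AG); apply: adj2_Alt. Qed.

(* The conjugating elements are 3-cycles, so this holds for [A_n] as well. *)
Lemma trace_double_transposition i j : (i.+1 < j)%N -> (j.+1 < n)%N ->
  \tr (pi (s i * s j)%g) = \tr (pi (s 0 * s 2)%g).
Proof.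
elim: i => [|i IHi].
  elim: j => [//|j IHj] ij jn; have [->//|j1] := eqVneq j 1%N.
  rewrite -IHj; try lia; rewrite -adj2_conj_right; try lia.
  by rewrite trace_piJ // adj2_G //; lia.
move=> ij jn; rewrite -IHi //; last by apply: ltnW.
by rewrite -adj2_conj_left // trace_piJ // adj2_G //; lia.
Qed.

(** The determinant has square 1 by orthogonality and cube 1 because the element is a 3-cycle. *)
Lemma det_adj2 i : (i.+2 < n)%N -> \det (pi (s i * s i.+1)%g) = 1.
Proof.
move=> h; set c := (s i * s i.+1)%g.
have cG : c \in G by apply: adj2_G => //; apply: ltnW.
have d2 : \det (pi c) * \det (pi c) = 1.
  by rewrite -{2}det_tr -det_mulmx opi // det1.
have /= := congr1 (fun g => \det (pi g)) (adj2_cube h).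
have ccG : (c * c)%g \in G by apply: groupM.
by rewrite -/c repr_mx1 det1 (repr_mxM pi cG ccG) (repr_mxM pi cG cG) !det_mulmx d2 mulr1.
Qed.

Lemma trace_s1s3 : exists2 m, ~~ odd m & \tr (pi (s 0 * s 2)%g) = N%:R - (2 * m)%:R.
Proof.
have s02 : (s 0 * s 2 \in G)%g by apply: adj2_G; lia.
have inv := @adj2_sqr n 0 2 isT n4.
have [m [tr_m det_m _]] := lift_involution (opi s02) (pi_involution s02 inv).
exists m => //; apply: (@sign_real1 R); rewrite -det_m.
have -> : (s 0 * s 2 = (s 0 * s 1) * (s 1 * s 2))%g.
  by rewrite mulgA -(mulgA (s 0)) adjK ?mulg1 //; lia.
by rewrite repr_mxM ?adj2_G ?det_mulmx ?det_adj2 ?mulr1 //; lia.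
Qed.

(** Of the two residues allowed by [spinorial_involution], 6 would make m odd, against
    [trace_s1s3]. *)
Lemma spinorial_s1s3 : spinorial G pi ->
  congr_mod (chi pi 1%g) (chi pi (s 0 * s 2)%g) 8.
Proof.
move=> sp; have [m em tr_m] := trace_s1s3.
have s02 : (s 0 * s 2 \in G)%g by apply: adj2_G; lia.
have inv := @adj2_sqr n 0 2 isT n4.
have [m' [tr_m' _ H]] := spinorial_involution sp s02 inv.
rewrite chi1 -[N%:R]subr0; apply/(congr_mod_natP 0 tr_m).
move: tr_m'; rewrite /chi tr_m => /addrI/oppr_inj/eqP; rewrite eqr_nat => /eqP E.
by rewrite -E in H; lia.
Qed.

Hypothesis chi_s1s3 : congr_mod (chi pi 1%g) (chi pi (s 0 * s 2)%g) 8.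

(** All these double transpositions have the same trace, so the hypothesis on s_1 s_3 decides the
    squares of all their lifts. *)
Lemma double_transposition_sqr i j (x : cliff R N) : (i.+1 < j)%N -> (j.+1 < n)%N ->
  Pin x -> rho_is x (pi (s i * s j)%g) -> x * x = 1.
Proof.
move=> ij jn Px rx; have [m em tr_m] := trace_s1s3.
have m8 : (m * 2 = 0 %[mod 8])%N.
  by rewrite mulnC; apply/(congr_mod_natP 0 tr_m); rewrite subr0 -chi1.
have ijG : (s i * s j \in G)%g by apply: adj2_G => //; lia.
have [m' [tr_m' _ ->]] := lift_involution (opi ijG) (pi_involution ijG (adj2_sqr ij jn)) => //.
move: tr_m'; rewrite trace_double_transposition // tr_m => /addrI/oppr_inj/eqP.
rewrite eqr_nat => /eqP E; apply/(cliff_bin_sign1 R N); left; lia.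
Qed.

(** The family [psi] is [pi (s i)] for S_n and [pi (s i * s 0)] for A_n; in both cases
    [psi i *m (psi j)^T] represents s_i s_j, so the relations for [twist] can be verified
    together. *)
Lemma twisted_lift (psi : nat -> 'M[R]_N) :
  (forall i, (i.+1 < n)%N -> orthogonal_mx (psi i)) ->
  (forall i j, (i.+1 < n)%N -> (j.+1 < n)%N ->
     psi i *m (psi j)^T = pi (s i * s j)%g) ->
  exists y y' : nat -> cliff R N,
  [/\ forall i, (i.+1 < n)%N -> Pin (y i) /\ rho_is (y i) (psi i),
      forall i, (i.+1 < n)%N -> Pin (y' i) /\ rho_is (y' i) (psi i)^T,
      forall i, (i.+1 < n)%N -> y i * y' i = 1 &
      exists Phi : bool -> 'S_n -> cliff R N,
      [/\ forall b, Phi b 1%g = 1,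
          forall b g i, (i.+1 < n)%N ->
            Phi b (g * s i)%g = Phi b g * (if b (+) odd_perm g then y' i else y i) &
          forall b g h, Phi b (g * h)%g = Phi b g * Phi (b (+) odd_perm g) h]].
Proof.
move=> opsi psiE; have lt_pred i : (i < n.-1)%N -> (i.+1 < n)%N by lia.
have pred_lt i : (i.+1 < n)%N -> (i < n.-1)%N by lia.
have [i /lt_pred|i /lt_pred ik|y [y' [Py Py' yy' y'y y3]]] := @lift_system R N n.-1 psi.
- exact: opsi.
- have iG := adj2_G (ltnW ik) ik; rewrite /= psiE // ?(ltnW ik) //.
  have iiG := groupM iG iG.
  by rewrite -(repr_mxM pi iG iG) -(repr_mxM pi iG iiG) adj2_cube ?repr_mx1.
exists y, y'; split=> [i /pred_lt|i /pred_lt|i /pred_lt|]; [exact: Py|exact: Py'|exact: yy'|].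
apply: twisted_product; first by lia.
apply: twist_coxeter => // i j ij /[dup] jk /lt_pred jn.
have ik : (i < n.-1)%N by lia.
apply: (@double_transposition_sqr i j) => //.
  by apply: PinM; [case: (Py _ ik)|case: (Py' _ jk)].
by rewrite -psiE ?lt_pred //; apply: rho_isM; [case: (Py _ ik)|case: (Py' _ jk)].
Qed.

Lemma spinorial_Sym : G = [set: 'S_n] :> {set _} ->
  congr_mod (chi pi 1%g) (chi pi (s 0)) 8 \/
    congr_mod (chi pi 1%g - 6) (chi pi (s 0)) 8 ->
  spinorial G pi.
Proof.
move=> GT chi_s1; have inG g : g \in G by rewrite GT inE.
have siV i : (i.+1 < n)%N -> ((s i)^-1 = s i)%g.
  by move=> h; apply/eqP; rewrite eq_invg_mul adjK.
have [|i j hi hj|y [y' [Py Py' yy' [Phi [Phi1 PhiS PhiM]]]]] :=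
  @twisted_lift (fun i => pi (s i)).
- by move=> i _; apply: opi.
- by rewrite tr_pi // siV // -repr_mxM.
have tr_s i : (i.+1 < n)%N -> \tr (pi (s i)) = \tr (pi (s 0)).
  by elim: i => // i IH h; rewrite adj_conj // trace_piJ // IH // ltnW.
(* The congruence for s_1 enters here, for all i since the s_i are conjugate. It makes [y'] equal to
   [y], so that [Phi] no longer depends on the flag and is multiplicative on all of S_n. *)
have y2 i : (i.+1 < n)%N -> y i * y i = 1.
  move=> h; have [Pi ri] := Py i h.
  have [m [tr_m _ ->]] := lift_involution (opi (inG (s i))) (pi_involution (inG _) (adjK h)) => //.
  have {}tr_m : chi pi (s 0) = N%:R - (2 * m)%:R by rewrite -tr_m tr_s.
  apply/(cliff_bin_sign1 R N); case: chi_s1 => H; [left|right].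
    by apply/(congr_mod_natP 0 tr_m); rewrite subr0 -chi1.
  by apply/(congr_mod_natP 6 tr_m); rewrite -chi1.
have yE i : (i.+1 < n)%N -> y' i = y i.
  by move=> h; rewrite -[LHS]mul1r -(y2 i h) -mulrA yy' // mulr1.
have PhiE b b' g : Phi b g = Phi b' g.
  elim/adj_ind: g => [|g i h IH]; first by rewrite !Phi1.
  by rewrite !PhiS // IH yE // !if_same.
exists (Phi false); split=> [g _|g h _ _|g _].
- elim/adj_ind: g => [|g i h IH]; first by rewrite Phi1; apply: Pin1.
  by rewrite PhiS // yE // if_same; apply: PinM => //; case: (Py i h).
- by rewrite PhiM (PhiE _ false).
- elim/adj_ind: g => [|g i h IH]; first by rewrite Phi1 repr_mx1; apply: rho_is1.
  by rewrite PhiS // yE // if_same repr_mxM //; apply: rho_isM => //; case: (Py i h).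
Qed.

Lemma spinorial_Alt : G = Alt 'I_n :> {set _} -> spinorial G pi.
Proof.
move=> GA; have GE g : (g \in G) = ~~ odd_perm g by rewrite GA Alt_even.
have n1 : (1 < n)%N by lia.
have siV i : (i.+1 < n)%N -> ((s i)^-1 = s i)%g.
  by move=> h; apply/eqP; rewrite eq_invg_mul adjK.
have psiT i : (i.+1 < n)%N -> (pi (s i * s 0)%g)^T = pi (s 0 * s i)%g.
  by move=> h; rewrite tr_pi ?adj2_G // invMg !siV.
have [|i j hi hj|y [y' [Py Py' yy' [Phi [Phi1 PhiS PhiM]]]]] :=
  @twisted_lift (fun i => pi (s i * s 0)%g).
- by move=> i h; apply: opi; apply: adj2_G.
- by rewrite psiT // -repr_mxM ?adj2_G // mulgA -(mulgA (s i)) adjK // mulg1.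
(* An odd g lies outside A_n; the invariant that survives multiplication by one generator at a time
   is that [Phi false g] then lifts the even element g s_1 ([s 0] in the code). *)
have PhiP g : Pin (Phi false g) /\
    rho_is (Phi false g) (pi (if odd_perm g then g * s 0 else g)%g).
  elim/adj_ind: g => [|g i h [Pg rg]].
    by rewrite Phi1 odd_perm1 repr_mx1; split; [apply: Pin1|apply: rho_is1].
  have [[Pi ri] [Pi' ri']] := (Py i h, Py' i h).
  rewrite PhiS // odd_permM odd_adj // addbT /=.
  case: (boolP (odd_perm g)) rg => og rg /=; split; try exact: PinM.
    have -> : (g * s i = (g * s 0) * (s 0 * s i))%g.
      by rewrite mulgA -(mulgA g) adjK // mulg1.
    have g0 : (g * s 0)%g \in G by rewrite GE odd_permM odd_adj // og.
    by rewrite (repr_mxM pi g0) ?adj2_G // -psiT //; apply: rho_isM.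
  by rewrite -mulgA (repr_mxM pi) ?GE ?odd_permM ?odd_adj //; apply: rho_isM.
exists (Phi false); split=> [g _|g h gG _|g gG].
- by case: (PhiP g).
- by rewrite PhiM; move: gG; rewrite GE => /negbTE ->.
- by have [_] := PhiP g; move: gG; rewrite GE => /negbTE ->.
Qed.

End Representation.


Theorem theorem1p1 (R : realType) (n : nat) (hn : (4 <= n)%N) :
  (forall (N : nat) (pi : mx_representation R [group of [set: 'S_n]] N),
     {in [set: 'S_n], forall g, orthogonal_mx (pi g)} ->
     (spinorial [group of [set: 'S_n]] pi <->
        congr_mod (chi pi 1%g) (chi pi (sadj n 1 * sadj n 3)%g) 8 /\
        (congr_mod (chi pi 1%g) (chi pi (sadj n 1)) 8 \/
         congr_mod (chi pi 1%g - 6) (chi pi (sadj n 1)) 8))) /\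
  (forall (N : nat) (pi : mx_representation R (Alt_group 'I_n) N),
     {in Alt 'I_n, forall g, orthogonal_mx (pi g)} ->
     (spinorial (Alt_group 'I_n) pi <->
        congr_mod (chi pi 1%g) (chi pi (sadj n 1 * sadj n 3)%g) 8)).
Proof.
split=> N pi opi.
  have AG : Alt 'I_n \subset [group of [set: 'S_n]] by apply: subsetT.
  have opi' : {in [group of [set: 'S_n]], forall g, orthogonal_mx (pi g)}.
    by move=> g _; apply: opi; rewrite inE.
  split=> [sp|[c13 c1]]; last exact: spinorial_Sym c1.
  split; first exact: (spinorial_s1s3 hn AG).
  have s0G : adj n 0 \in [group of [set: 'S_n]] by rewrite inE.
  have [m [tr_m _ H]] := spinorial_involution opi' sp s0G (adjK (ltnW (ltnW hn))).
  rewrite chi1; case: H => H; [left|right]; last exact/(congr_mod_natP 6 tr_m).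
  by rewrite -[N%:R]subr0; apply/(congr_mod_natP 0 tr_m).
split=> [sp|c13]; first exact: (spinorial_s1s3 hn (subxx _)).
exact: (@spinorial_Alt R n (Alt_group 'I_n) N pi hn (subxx _)).
Qed.
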